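(* For each integer $n\ge 1$ let $\psi_n,\phi_n,\omega_n$ denote the values at the point $P=(-3,9)$ of the division polynomials of the elliptic curve $E_6: y^2=x^3-36x$ (as specified in the context), and put $$X_n=\phi_n^4+1296\psi_n^8+864\phi_n\psi_n^6+72\phi_n^2\psi_n^4+144\omega_n\psi_n^5-24\phi_n^3\psi_n^2+4\phi_n^2\omega_n\psi_n,$$ $$Y_n=-864\phi_n\psi_n^6-\phi_n^4-1296\psi_n^8-72\phi_n^2\psi_n^4+144\omega_n\psi_n^5+24\phi_n^3\psi_n^2+4\phi_n^2\omega_n\psi_n,$$ $$U_n=4(\phi_n^2+36\psi_n^4)\omega_n\psi_n,$$ $$V_n=(\phi_n^2-36\psi_n^4-12\phi_n\psi_n^2)(\phi_n^2-36\psi_n^4+12\phi_n\psi_n^2).$$ Then for every $n\ge 1$, $(X_n,Y_n,U_n,V_n)$ is an integer solution of $X^4+Y^4=2(U^4+V^4)$; and, with $d_n=\gcd(X_n,Y_n,U_n,V_n)$, the quadruple $(A_n,B_n,C_n,D_n)=(X_n/d_n,\,Y_n/d_n,\,U_n/d_n,\,V_n/d_n)$ is a primitive solution of the same equation. In particular, the equation $X^4+Y^4=2(U^4+V^4)$ has infinitely many integer solutions.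
   Context: An integer solution $(A,B,C,D)$ of the equation is called primitive if $\gcd(A,B,C,D)=1$. The division polynomials of $E_6: y^2=x^3-36x$ are defined by $\psi_{-1}=-1$, $\psi_0=0$, $\psi_1=1$, $\psi_2=2y$, $\psi_3=3x^4-216x^2-1296$, $\psi_4=4y(x^6-180x^4-6480x^2+46656)$, and recursively by $\psi_{2m+1}=\psi_{m+2}\psi_m^3-\psi_{m-1}\psi_{m+1}^3$ for $m\ge 2$ and $\psi_{2m}=(2y)^{-1}\psi_m(\psi_{m+2}\psi_{m-1}^2-\psi_{m-2}\psi_{m+1}^2)$ for $m\ge 3$. Further, for $n\ge 1$, $\phi_n=x\psi_n^2-\psi_{n+1}\psi_{n-1}$ and $\omega_n=(4y)^{-1}(\psi_{n+2}\psi_{n-1}^2-\psi_{n-2}\psi_{n+1}^2)$. All of these are evaluated at $(x,y)=(-3,9)$, which is a point of $E_6(\mathbb{Q})$ of infinite order; one has $nP=\left(\phi_n/\psi_n^2,\ \omega_n/\psi_n^3\right)$ in the group $E_6(\mathbb{Q})$. *)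

(* Defs.v *)
From HB Require Import structures.
From mathcomp Require Import all_boot all_order all_algebra.
From mathcomp Require Import classical_sets cardinality.
From mathcomp Require Import ring zify.

Set Implicit Arguments.
Unset Strict Implicit.
Unset Printing Implicit Defensive.

Import Order.TTheory GRing.Theory Num.Theory.
Local Open Scope ring_scope.

(* Q[x, y] is {poly {poly rat}}, with y the outer and x the inner variable. *)
Definition xvar : {poly {poly rat}} := 'X%:P.
Definition yvar : {poly {poly rat}} := 'X.

Definition psi3 : {poly {poly rat}} :=
  3 * xvar ^+ 4 - 216 * xvar ^+ 2 - 1296.

(* 5 * 36 ^+ 2 = 6480 and 36 ^+ 3 = 46656. *)
Definition psi4 : {poly {poly rat}} :=
  4 * yvar
  * (xvar ^+ 6 - 180 * xvar ^+ 4 - 5 * 36 ^+ 2 * xvar ^+ 2 + 36 ^+ 3).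

(* The division polynomials of y ^ 2 = x ^ 3 - 36 x at indices n >= 0. The
   recursive calls are at indices < n, so any fuel k >= n gives the same
   polynomial. The quotient by 2 y is exact: see psi_even below. *)
Fixpoint psi_fuel (k n : nat) : {poly {poly rat}} :=
  match n with
  | 0 => 0
  | 1 => 1
  | 2 => 2 * yvar
  | 3 => psi3
  | 4 => psi4
  | _ =>
    if k is k'.+1 then
      let f := psi_fuel k' in
      let m := n./2 in
      if odd n then
        f m.+2 * f m ^+ 3 - f m.-1 * f m.+1 ^+ 3
      else
        (f m * (f m.+2 * f m.-1 ^+ 2 - f m.-2 * f m.+1 ^+ 2)) %/ (2 * yvar)
    else 0
  end.

(* The only negative index that is ever used is -1, where the value is -1; the
   other negative indices follow the usual convention psi_(-n) = - psi_n. *)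
Definition psi (z : int) : {poly {poly rat}} :=
  match z with
  | Posz n => psi_fuel n n
  | Negz n => - psi_fuel n.+1 n.+1
  end.

Lemma psi_fuelS k n :
  psi_fuel k.+1 n.+4.+1 =
  let f := psi_fuel k in
  let m := (n.+1)./2 in
  if odd n then
    (f m.+2 * (f m.+4 * f m.+1 ^+ 2 - f m * f m.+3 ^+ 2)) %/ (2 * yvar)
  else f m.+4 * f m.+2 ^+ 3 - f m.+1 * f m.+3 ^+ 3.
Proof.
have -> : psi_fuel k.+1 n.+4.+1 =
  if odd n.+4.+1 then
    psi_fuel k (n.+4.+1)./2.+2 * psi_fuel k (n.+4.+1)./2 ^+ 3
    - psi_fuel k (n.+4.+1)./2.-1 * psi_fuel k (n.+4.+1)./2.+1 ^+ 3
  else (psi_fuel k (n.+4.+1)./2 *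
    (psi_fuel k (n.+4.+1)./2.+2 * psi_fuel k (n.+4.+1)./2.-1 ^+ 2
    - psi_fuel k (n.+4.+1)./2.-2 * psi_fuel k (n.+4.+1)./2.+1 ^+ 2))
    %/ (2 * yvar) by [].
have -> : odd n.+4.+1 = ~~ odd n by rewrite !oddS !negbK.
have -> : (n.+4.+1)./2 = (n.+1)./2.+2 by [].
by rewrite /=; case: (odd n).
Qed.

Lemma psi_fuelE k n : (n <= k)%N -> psi_fuel k n = psi_fuel n n.
Proof.
elim/ltn_ind: n k => n IH k.
case: n IH => [|[|[|[|[|n]]]]] IH; try by case: k.
case: k => [|k] le_nk; first by [].
have lo : ((n.+1)./2 <= n)%N by lia.
have [l1 l2 l3 l4] : [/\ (n.+1./2 <= n.+1./2.+1)%N, (n.+1./2 <= n.+1./2.+2)%N,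
    (n.+1./2 <= n.+1./2.+3)%N & (n.+1./2 <= n.+1./2.+4)%N].
  by rewrite !leqW.
have E j i : (n.+4 <= j)%N -> (i <= (n.+1)./2.+4)%N ->
    psi_fuel j i = psi_fuel i i.
  move=> hj hi; have hin : (i <= n.+4)%N by apply: leq_trans hi _.
  by apply: IH; [rewrite ltnS|apply: leq_trans hj].
rewrite !psi_fuelS; cbv zeta.
set m := n.+1./2 in E l1 l2 l3 l4 *.
have Em i : (i <= m.+4)%N -> psi_fuel k i = psi_fuel n.+4 i.
  by move=> hi; rewrite (E k) // (E n.+4).
by rewrite (Em m) // (Em m.+1) // (Em m.+2) // (Em m.+3) // (Em m.+4).
Qed.

Lemma psi_nat k n : (n <= k)%N -> psi n%:Z = psi_fuel k n.
Proof. by move=> h; rewrite (psi_fuelE h). Qed.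

Lemma psi_odd (m : nat) : (2 <= m)%N ->
  psi (m%:Z * 2 + 1) =
    psi (m%:Z + 2) * psi m%:Z ^+ 3 - psi (m%:Z - 1) * psi (m%:Z + 1) ^+ 3.
Proof.
case: m => [|[|m]]; try by [].
move=> _.
have -> : m.+2%:Z * 2 + 1 = (m.*2).+4.+1%:Z by rewrite -PoszM -PoszD muln2 addn1.
have -> : m.+2%:Z + 2 = m.+4%:Z by rewrite -PoszD !addnS addn0.
have -> : m.+2%:Z + 1 = m.+3%:Z by rewrite -PoszD addn1.
have -> : m.+2%:Z - 1 = m.+1%:Z by rewrite -[m.+2]addn1 PoszD addrK.
have lo : (m <= m.*2)%N by rewrite -addnn leq_addr.
rewrite [LHS]/psi psi_fuelS odd_double [_./2]uphalf_double; cbv zeta iota.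
have E i : (i <= m.+4)%N -> psi i%:Z = psi_fuel m.*2.+4 i.
  by move=> hi; apply: psi_nat; apply: leq_trans hi _.
have [l1 l2 l3] : [/\ (m < m.+4)%N, (m.+1 < m.+4)%N & (m.+2 < m.+4)%N].
  split; [exact: (leq_addl 3 m.+1)|exact: (leq_addl 2 m.+2)|exact: (leq_addl 1 m.+3)].
by rewrite (E _ l1) (E _ l2) (E _ l3) (E _ (leqnn _)).
Qed.

Lemma psi_half (m : nat) : (3 <= m)%N ->
  psi (m%:Z * 2) =
    (psi m%:Z * (psi (m%:Z + 2) * psi (m%:Z - 1) ^+ 2
                 - psi (m%:Z - 2) * psi (m%:Z + 1) ^+ 2)) %/ (2 * yvar).
Proof.
case: m => [|[|[|m]]]; try by [].
move=> _.
have -> : m.+3%:Z * 2 = (m.*2.+1).+4.+1%:Z by rewrite -PoszM muln2.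
have -> : m.+3%:Z + 2 = m.+4.+1%:Z by rewrite -PoszD !addnS addn0.
have -> : m.+3%:Z + 1 = m.+4%:Z by rewrite -PoszD addn1.
have -> : m.+3%:Z - 1 = m.+2%:Z by rewrite -[m.+3]addn1 PoszD addrK.
have -> : m.+3%:Z - 2 = m.+1%:Z by rewrite -[m.+3]addn2 PoszD addrK.
have lo : (m <= m.*2)%N by rewrite -addnn leq_addr.
rewrite [LHS]/psi psi_fuelS oddS odd_double -doubleS doubleK; cbv zeta iota.
have E i : (i <= m.+4.+1)%N -> psi i%:Z = psi_fuel m.*2.+4.+1 i.
  by move=> hi; apply: psi_nat; apply: leq_trans hi _.
have [l1 l2 l3 l4] : [/\ (m < m.+4.+1)%N, (m.+1 < m.+4.+1)%N,
    (m.+2 < m.+4.+1)%N & (m.+3 < m.+4.+1)%N].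
  split; [exact: (leq_addl 4 m.+1)|exact: (leq_addl 3 m.+2)|
          exact: (leq_addl 2 m.+3)|exact: (leq_addl 1 m.+4)].
by rewrite (E _ l1) (E _ l2) (E _ l3) (E _ l4) (E _ (leqnn _)).
Qed.

Lemma mul_yK (c : nat) (q : {poly {poly rat}}) : (0 < c)%N ->
  (c%:R * yvar * q) %/ (c%:R * yvar) = q.
Proof.
move=> c0; rewrite mulrC Pdiv.IdomainUnit.mulpK //.
rewrite lead_coefM lead_coefX mulr1 -polyC_natr lead_coefC.
by rewrite -polyC_natr rmorph_unit // unitfE pnatr_eq0 -lt0n.
Qed.

Lemma psi_double_spec (m : nat) :
  (exists q, psi (m%:Z * 2) = 2 * yvar * q) /\
  ((3 <= m)%N -> 2 * yvar * psi (m%:Z * 2) =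
    psi m%:Z * (psi (m%:Z + 2) * psi (m%:Z - 1) ^+ 2
                - psi (m%:Z - 2) * psi (m%:Z + 1) ^+ 2)).
Proof.
elim/ltn_ind: m => m IH.
have [lem|] := leqP 3 m; last first.
  case: m {IH} => [|[|[|m]]] // _; split=> //.
  - by exists 0; rewrite mulr0.
  - by exists 1; rewrite mulr1.
  - exists (2 * (xvar ^+ 6 - 180 * xvar ^+ 4 - 5 * 36 ^+ 2 * xvar ^+ 2 + 36 ^+ 3)).
    rewrite -[LHS]/psi4 /psi4 -!mulrA; ring.
have [q Eq] : exists q, psi m%:Z * (psi (m%:Z + 2) * psi (m%:Z - 1) ^+ 2
                - psi (m%:Z - 2) * psi (m%:Z + 1) ^+ 2) = 2 * yvar * (2 * yvar * q).
  have D (k : int) (i : nat) : (i < m)%N -> k = i%:Z * 2 -> exists q, psi k = 2 * yvar * q.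
    by move=> /IH[] ? _ ->.
  have [odm|evm] := boolP (odd m).
    have [||q1 E1] := D (m%:Z - 1) m./2; [lia|lia|].
    have [||q2 E2] := D (m%:Z + 1) m./2.+1; [lia|lia|].
    exists (psi m%:Z * (psi (m%:Z + 2) * q1 ^+ 2 - psi (m%:Z - 2) * q2 ^+ 2)).
    by rewrite E1 E2; ring.
  have [||q1 E1] := D (m%:Z - 2) (m./2).-1; [lia|lia|].
  have [||q2 E2] := D (m%:Z + 2) m./2.+1; [lia|lia|].
  have [||q3 E3] := D m%:Z m./2; [lia|lia|].
  exists (q3 * (q2 * psi (m%:Z - 1) ^+ 2 - q1 * psi (m%:Z + 1) ^+ 2)).
  by rewrite E1 E2 E3; ring.
have E : psi (m%:Z * 2) = 2 * yvar * q by rewrite psi_half // Eq mul_yK.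
by split=> [|_]; [exists q | rewrite Eq E].
Qed.

Lemma psi_even (m : nat) : (3 <= m)%N ->
  2 * yvar * psi (m%:Z * 2) =
    psi m%:Z * (psi (m%:Z + 2) * psi (m%:Z - 1) ^+ 2
                - psi (m%:Z - 2) * psi (m%:Z + 1) ^+ 2).
Proof. by case: (psi_double_spec m). Qed.

Definition phi (n : nat) : {poly {poly rat}} :=
  xvar * psi n%:Z ^+ 2 - psi (n%:Z + 1) * psi (n%:Z - 1).

(* The quotient by 4 y is exact for n >= 1: see omega_exact below. *)
Definition omega (n : nat) : {poly {poly rat}} :=
  (psi (n%:Z + 2) * psi (n%:Z - 1) ^+ 2
   - psi (n%:Z - 2) * psi (n%:Z + 1) ^+ 2) %/ (4 * yvar).

Lemma omega_exact (n : nat) : (1 <= n)%N ->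
  4 * yvar * omega n =
    psi (n%:Z + 2) * psi (n%:Z - 1) ^+ 2 - psi (n%:Z - 2) * psi (n%:Z + 1) ^+ 2.
Proof.
move=> n_gt0.
suff [q E] : exists q, psi (n%:Z + 2) * psi (n%:Z - 1) ^+ 2
    - psi (n%:Z - 2) * psi (n%:Z + 1) ^+ 2 = 4 * yvar * q.
  by rewrite /omega E mul_yK.
have D (k : int) (i : nat) : k = i%:Z * 2 -> exists q, psi k = 2 * yvar * q.
  by move=> ->; case: (psi_double_spec i).
have [odn|evn] := boolP (odd n).
  have [|q1 E1] := D (n%:Z - 1) n./2; first by lia.
  have [|q2 E2] := D (n%:Z + 1) n./2.+1; first by lia.
  exists (yvar * (psi (n%:Z + 2) * q1 ^+ 2 - psi (n%:Z - 2) * q2 ^+ 2)).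
  by rewrite E1 E2; ring.
have [|q1 E1] := D (n%:Z - 2) (n./2).-1; first by lia.
have [|q2 E2] := D (n%:Z + 2) n./2.+1; first by lia.
exists (2^-1%:P%:P * (q2 * psi (n%:Z - 1) ^+ 2 - q1 * psi (n%:Z + 1) ^+ 2)).
have h : 2 * 2^-1%:P%:P = 1 :> {poly {poly rat}}.
  by rewrite -!polyC_natr -!polyCM.
rewrite E1 E2; set a := psi _; set b := psi _.
transitivity (2 * yvar * (2 * 2^-1%:P%:P) * (q2 * a ^+ 2 - q1 * b ^+ 2)); last by ring.
by rewrite h; ring.
Qed.

(* Value at the point P = (-3, 9): y is replaced by 9, then x by -3. *)
Definition evalP (p : {poly {poly rat}}) : rat := p.[9%:P].[-3].

Definition psiP (n : nat) : rat := evalP (psi n%:Z).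
Definition phiP (n : nat) : rat := evalP (phi n).
Definition omegaP (n : nat) : rat := evalP (omega n).

Definition Xval (n : nat) : rat :=
  let s := psiP n in let f := phiP n in let w := omegaP n in
  f ^+ 4 + 1296 * s ^+ 8 + 864 * f * s ^+ 6 + 72 * f ^+ 2 * s ^+ 4
  + 144 * w * s ^+ 5 - 24 * f ^+ 3 * s ^+ 2 + 4 * f ^+ 2 * w * s.

Definition Yval (n : nat) : rat :=
  let s := psiP n in let f := phiP n in let w := omegaP n in
  - (864 * f * s ^+ 6) - f ^+ 4 - 1296 * s ^+ 8 - 72 * f ^+ 2 * s ^+ 4
  + 144 * w * s ^+ 5 + 24 * f ^+ 3 * s ^+ 2 + 4 * f ^+ 2 * w * s.

Definition Uval (n : nat) : rat :=
  let s := psiP n in let f := phiP n in let w := omegaP n in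
  4 * (f ^+ 2 + 36 * s ^+ 4) * w * s.

Definition Vval (n : nat) : rat :=
  let s := psiP n in let f := phiP n in
  (f ^+ 2 - 36 * s ^+ 4 - 12 * f * s ^+ 2)
  * (f ^+ 2 - 36 * s ^+ 4 + 12 * f * s ^+ 2).

Definition gcd4 (a b c d : int) : int := gcdz (gcdz (gcdz a b) c) d.

Definition solution (q : int * int * int * int) : Prop :=
  let: (a, b, c, d) := q in a ^+ 4 + b ^+ 4 = 2 * (c ^+ 4 + d ^+ 4).

Definition primitive_solution (q : int * int * int * int) : Prop :=
  solution q /\ (let: (a, b, c, d) := q in gcd4 a b c d = 1).

(* Main.v *)
Require Import Defs.
From HB Require Import structures.
From mathcomp Require Import all_boot all_order all_algebra.
From mathcomp Require Import classical_sets cardinality.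
From mathcomp Require Import ring zify.

Set Implicit Arguments.
Unset Strict Implicit.
Unset Printing Implicit Defensive.

Import Order.TTheory GRing.Theory Num.Theory.
Local Open Scope ring_scope.
Local Open Scope classical_set_scope.

(** The heart of the proof is that nP stays on the curve, that is,
    omega_n ^ 2 = phi_n ^ 3 - 36 phi_n psi_n ^ 4, although only the duplication
    formulas for the division polynomials are given. No group law is used: the
    sequence u_n = psi_n(P) is shown to be a Somos-4 sequence,
      u_(n+2) u_(n-2) = psi_2 ^ 2 u_(n+1) u_(n-1) - psi_3 u_n ^ 2.
    The duplication formulas propagate this relation from the centres n - 1, n
    and n + 1 to the centres 2 n and 2 n + 1 ([somos4_even], [somos4_odd]), so
    it follows by strong induction ([psiP_spec]). A Somos-4 sequence has a first
    integral, equal to -18 here; the relation and its first integral give the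
    sum and the product of u_(n+2) u_(n-1) ^ 2 and u_(n-2) u_(n+1) ^ 2, hence
    the square of their difference 36 omega_n, and this is the equation of the
    curve ([on_curve_of_somos4]).

    Propagation divides by terms of the sequence, so the induction also proves
    that these do not vanish, and it does so by parity: psi_n is an integer with
    the parity of n, and phi_n is odd. By the curve equation omega_n ^ 2 is an
    odd integer, so omega_n is an odd integer, and psi_(2n) = 2 psi_n omega_n is
    a nonzero even integer.

    For the quartic, X = U + A and Y = U - A with an explicit form A, so that
    X ^ 4 + Y ^ 4 = 2 (U ^ 4 + A ^ 2 (A ^ 2 + 6 U ^ 2)), and the curve equation
    turns A ^ 2 (A ^ 2 + 6 U ^ 2) into V ^ 4 ([quartic_identity]). Since V_n is
    odd, so is d_n. At n = 2 ^ k the 2-adic valuation of U_n is k + 2, and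
    division by the odd d_n preserves it; the primitive solutions with
    n = 2 ^ k are therefore pairwise distinct. *)

(** * Somos-4 sequences and duplication formulas *)

(** The Somos-4 relation is centred at [k.+2]. *)
Definition somos4 (R : pzRingType) (al be : R) (u : nat -> R) (k : nat) : Prop :=
  u k.+4 * u k = al * u k.+3 * u k.+1 + be * u k.+2 ^+ 2.

(** The quotient of the left-hand side by u_(k+1) u_(k+2) u_(k+3) does not depend
    on [k] when [u] is a Somos-4 sequence with nonzero terms; [J] is its value. *)
Definition somos4_first_integral (R : pzRingType) (al J : R) (u : nat -> R)
    (k : nat) : Prop :=
  u k.+1 ^+ 2 * u k.+4 + u k.+3 ^+ 2 * u k + al * u k.+2 ^+ 3
    = J * u k.+1 * u k.+2 * u k.+3.

(** Multiplied by [u k.+1], the relation centred at [k.+3] becomes [u k.+4] times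
    the one centred at [k.+2]: each side uses one of the two Somos-4 relations
    to remove the products of terms four apart. *)
Lemma somos4_first_integralS (F : fieldType) (al be J : F) (u : nat -> F) k :
  u k.+1 != 0 -> somos4 al be u k -> somos4 al be u k.+1 ->
  somos4_first_integral al J u k -> somos4_first_integral al J u k.+1.
Proof.
rewrite /somos4 /somos4_first_integral => u1 S0 S1 T0.
apply: (mulIf u1).
transitivity (u k.+4 * (J * u k.+1 * u k.+2 * u k.+3)); last by ring.
rewrite -T0.
transitivity (u k.+2 ^+ 2 * (u k.+1.+4 * u k.+1)
  + u k.+4 ^+ 2 * u k.+1 ^+ 2 + al * u k.+3 ^+ 3 * u k.+1); first by ring.
transitivity (u k.+3 ^+ 2 * (u k.+4 * u k)
  + u k.+4 ^+ 2 * u k.+1 ^+ 2 + al * u k.+2 ^+ 3 * u k.+4); last by ring.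
by rewrite S0 S1; ring.
Qed.

(** The three relations determine [a], [g] and [be] as rational functions of
    [al], [b], [c], [d], [e], [f]; after this elimination the claim is an
    identity between rational functions. When [a], ..., [g] are u_(n-3), ...,
    u_(n+3) and [al] is u_2 ^ 2, the duplication formulas turn the claim into
    u_2 ^ 2 times the Somos-4 relation centred at 2 n. *)
Lemma somos4_duplication_even (F : fieldType) (al be a b c d e f g : F) :
  c != 0 -> d != 0 -> e != 0 ->
  e * a = al * d * b + be * c ^+ 2 ->
  f * b = al * e * c + be * d ^+ 2 ->
  g * c = al * f * d + be * e ^+ 2 ->
  (e * (g * d ^+ 2 - c * f ^+ 2)) * (c * (e * b ^+ 2 - a * d ^+ 2)) =
  al * (al * (f * d ^+ 3 - c * e ^+ 3) * (e * c ^+ 3 - b * d ^+ 3))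
  + be * (d * (f * c ^+ 2 - b * e ^+ 2)) ^+ 2.
Proof.
move=> c0 d0 e0 Ea Eb Eg.
have -> : a = (al * d * b + be * c ^+ 2) / e by rewrite -Ea; field.
have -> : g = (al * f * d + be * e ^+ 2) / c by rewrite -Eg; field.
have -> : be = (f * b - al * e * c) / d ^+ 2 by rewrite Eb; field.
by field; rewrite ?c0 ?d0 ?e0.
Qed.

(** As in the even case, with [g] and [be] eliminated; now [b], ..., [g] are
    u_(n-2), ..., u_(n+3) and the centre is 2 n + 1. *)
Lemma somos4_duplication_odd (F : fieldType) (al be b c d e f g : F) :
  c != 0 -> d != 0 ->
  f * b = al * e * c + be * d ^+ 2 ->
  g * c = al * f * d + be * e ^+ 2 ->
  (g * e ^+ 3 - d * f ^+ 3) * (e * c ^+ 3 - b * d ^+ 3) =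
  e * (g * d ^+ 2 - c * f ^+ 2) * (d * (f * c ^+ 2 - b * e ^+ 2))
  + be * (f * d ^+ 3 - c * e ^+ 3) ^+ 2.
Proof.
move=> c0 d0 Eb Eg.
have -> : g = (al * f * d + be * e ^+ 2) / c by rewrite -Eg; field.
have -> : be = (f * b - al * e * c) / d ^+ 2 by rewrite Eb; field.
by field; rewrite ?c0 ?d0.
Qed.

(** Indices are shifted so that no natural number subtraction occurs: the
    formula for 2 n + 1 is at n = [m.+1], the one for 2 n below at n = [m.+2]. *)
Definition odd_duplication (R : pzRingType) (u : nat -> R) : Prop :=
  forall m, u m.+1.*2.+1 = u m.+3 * u m.+1 ^+ 3 - u m * u m.+2 ^+ 3.

Definition even_duplication (R : pzRingType) (u2 : R) (u : nat -> R) : Prop :=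
  forall m, u2 * u m.+2.*2 =
    u m.+2 * (u m.+4 * u m.+1 ^+ 2 - u m * u m.+3 ^+ 2).

(** From the centres n = [j.+2] and n + 1 to the centre 2 n + 1. *)
Lemma somos4_odd (F : fieldType) (u2 be : F) (u : nat -> F) j :
  odd_duplication u -> even_duplication u2 u ->
  u j.+1 != 0 -> u j.+2 != 0 ->
  somos4 (u2 ^+ 2) be u j -> somos4 (u2 ^+ 2) be u j.+1 ->
  somos4 (u2 ^+ 2) be u j.+1.*2.+1.
Proof.
move=> Do De c0 d0 S0 S1; have := somos4_duplication_odd c0 d0 S0 S1.
have E1 := De j; have E3 := De j.+1.
have E0 := Do j; have E2 := Do j.+1; have E4 := Do j.+2.
rewrite -E1 -E3 -E0 -E2 -E4 /somos4 !doubleS => ->.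
by ring.
Qed.

(** From the centres n - 1, n = [j.+3] and n + 1 to the centre 2 n. *)
Lemma somos4_even (F : fieldType) (u2 be : F) (u : nat -> F) j :
  odd_duplication u -> even_duplication u2 u -> u2 != 0 ->
  u j.+2 != 0 -> u j.+3 != 0 -> u j.+4 != 0 ->
  somos4 (u2 ^+ 2) be u j -> somos4 (u2 ^+ 2) be u j.+1 ->
  somos4 (u2 ^+ 2) be u j.+2 -> somos4 (u2 ^+ 2) be u j.+2.*2.
Proof.
move=> Do De u20 c0 d0 e0 S0 S1 S2.
have := somos4_duplication_even c0 d0 e0 S0 S1 S2.
have E0 := De j; have E2 := De j.+1; have E4 := De j.+2.
have E1 := Do j.+1; have E3 := Do j.+2.
rewrite -E0 -E2 -E4 -E1 -E3 /somos4 !doubleS => E.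
apply: (@mulfI _ (u2 ^+ 2)); first by rewrite expf_neq0.
transitivity (u2 * u j.+4.*2 * (u2 * u j.+2.*2)).
  by rewrite !doubleS; ring.
by rewrite !doubleS E; ring.
Qed.

(** The starting indices that [somos4_odd] and [somos4_even] do not reach; they
    are centred at 2, 3 and 4. *)
Lemma somos4_initial (F : fieldType) (u2 : F) (u : nat -> F) k :
  odd_duplication u -> even_duplication u2 u -> u2 != 0 ->
  u 0 = 0 -> u 1 = 1 -> u 2 = u2 ->
  (k <= 2)%N -> somos4 (u2 ^+ 2) (- u 3) u k.
Proof.
move=> Do De u20 E0 E1 E2; rewrite /somos4; case: k => [|[|[|//]]] _.
- by rewrite E0 E1 E2; ring.
- by rewrite (Do 1) E1 E2; ring.
have E6 : u2 * u 6 = _ := De 1.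
apply: (mulfI u20); transitivity (u2 * u 6 * u 2); first by ring.
by rewrite E6 E1 E2; ring.
Qed.

(** * Division polynomials at the point (-3, 9) *)

Lemma evalPM p q : evalP (p * q) = evalP p * evalP q.
Proof. by rewrite /evalP !hornerM. Qed.

Lemma evalPB p q : evalP (p - q) = evalP p - evalP q.
Proof. by rewrite /evalP !hornerE. Qed.

Lemma evalPX p n : evalP (p ^+ n) = evalP p ^+ n.
Proof. by rewrite /evalP !horner_exp. Qed.

Lemma evalP_nat n : evalP n%:R = n%:R.
Proof. by rewrite /evalP -!polyC_natr !hornerC. Qed.

Lemma evalP_x : evalP xvar = -3.
Proof. by rewrite /evalP /xvar hornerC hornerX. Qed.

Lemma evalP_y : evalP yvar = 9.
Proof. by rewrite /evalP /yvar hornerX hornerC. Qed.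

Lemma psiP0 : psiP 0 = 0.
Proof. by rewrite /psiP /evalP !horner0. Qed.

Lemma psiP1 : psiP 1 = 1.
Proof. by rewrite /psiP /evalP !hornerC. Qed.

Lemma psiP2 : psiP 2 = 18.
Proof. by rewrite /psiP [psi _]/= evalPM evalP_y (evalP_nat 2); ring. Qed.

Lemma psiP3 : psiP 3 = - 2997.
Proof.
rewrite /psiP [psi _]/= /psi3 !(evalPB, evalPM, evalPX) evalP_x.
by rewrite (evalP_nat 3) (evalP_nat 216) (evalP_nat 1296); ring.
Qed.

(** The value -918540 is written in factored form because its unary numeral is
    too large to handle. *)
Lemma psiP4 : psiP 4 = - (140 * 3 ^+ 8).
Proof.
(* The sum is written as a difference so that one family of rewrite rules
   evaluates everything. *)
have -> : psiP 4 = evalP (4 * yvar * (xvar ^+ 6 - 180 * xvar ^+ 4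
    - 5 * 36 ^+ 2 * xvar ^+ 2 - (0 - 36 ^+ 3))).
  by rewrite sub0r opprK.
rewrite !(evalPB, evalPM, evalPX) evalP_x evalP_y.
rewrite (evalP_nat 4) (evalP_nat 180) (evalP_nat 5) (evalP_nat 36) (evalP_nat 0).
by ring.
Qed.

Lemma psiP_odd : odd_duplication psiP.
Proof.
case=> [|m]; first by rewrite psiP0 psiP1 psiP3; ring.
rewrite /psiP -!evalPX -!evalPM -evalPB; congr evalP.
have -> : m.+2.*2.+1%:Z = m.+2%:Z * 2 + 1 by lia.
rewrite psi_odd //; congr (psi _ * _ - psi _ * psi _ ^+ _); lia.
Qed.

Lemma psiP_even : even_duplication 18 psiP.
Proof.
case=> [|m]; first by rewrite psiP0 psiP1 psiP2; ring.
have -> : 18 = evalP (2 * yvar) by rewrite evalPM evalP_y (evalP_nat 2); ring.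
rewrite /psiP -!evalPX -!evalPM -evalPB -!evalPM; congr evalP.
have -> : m.+3.*2%:Z = m.+3%:Z * 2 by lia.
rewrite psi_even //.
congr (_ * (psi _ * psi _ ^+ _ - psi _ * psi _ ^+ _)); lia.
Qed.

Lemma phiPE n :
  phiP n.+1 = - 3 * psiP n.+1 ^+ 2 - psiP n.+2 * psiP n.
Proof.
rewrite /phiP /phi evalPB evalPM evalPX evalPM evalP_x /psiP.
by congr (_ - evalP (psi _) * evalP (psi _)); lia.
Qed.

Lemma omegaPE n :
  36 * omegaP n.+2 = psiP n.+4 * psiP n.+1 ^+ 2 - psiP n * psiP n.+3 ^+ 2.
Proof.
have -> : 36 = evalP (4 * yvar) by rewrite evalPM evalP_y (evalP_nat 4); ring.
rewrite /omegaP -evalPM omega_exact // evalPB 2!(evalPM _ (_ ^+ _)) !evalPX /psiP.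
by congr (evalP (psi _) * evalP (psi _) ^+ _
  - evalP (psi _) * evalP (psi _) ^+ _); lia.
Qed.

Lemma omegaP1 : omegaP 1 = 9.
Proof.
apply: (@mulfI _ 36) => //.
have -> : 36 * omegaP 1 = evalP (4 * yvar) * omegaP 1.
  by rewrite evalPM evalP_y (evalP_nat 4); ring.
(* At n = 1 the index n - 2 is negative, and psi_(-1) = - psi_1. *)
have psi_m1 : evalP (psi (1%:Z - 2)) = - psiP 1.
  by rewrite /psiP /evalP /= !(hornerN, hornerC).
rewrite /omegaP -evalPM omega_exact // evalPB 2!(evalPM _ (_ ^+ _)) !evalPX.
rewrite psi_m1 -[evalP (psi (1%:Z - 1))]/(psiP 0) -[evalP (psi (1%:Z + 1))]/(psiP 2).
by rewrite psiP0 psiP1 psiP2; ring.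
Qed.

Lemma psiP_double n : (0 < n)%N -> psiP n.*2 = 2 * psiP n * omegaP n.
Proof.
case: n => [|[|n]] // _; first by rewrite psiP1 psiP2 omegaP1; ring.
apply: (@mulfI _ 18) => //; rewrite psiP_even -omegaPE; ring.
Qed.

Definition on_curve (n : nat) : Prop :=
  omegaP n ^+ 2 = phiP n ^+ 3 - 36 * phiP n * psiP n ^+ 4.

(** With A = psi_(n+2) psi_(n-1) ^ 2 and B = psi_(n-2) psi_(n+1) ^ 2, the first
    integral gives A + B, the Somos-4 relation gives A B, and
    (36 omega_n) ^ 2 = (A - B) ^ 2 = (A + B) ^ 2 - 4 A B. The constants
    18 ^ 2 = psi_2 ^ 2, 2997 = - psi_3 and -18 are those for which the result is
    the equation of the curve. *)
Lemma on_curve_of_somos4 k :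
  somos4 (18 ^+ 2) 2997 psiP k -> somos4_first_integral (18 ^+ 2) (-18) psiP k ->
  on_curve k.+2.
Proof.
rewrite /somos4 /somos4_first_integral /on_curve => S T.
apply: (@mulfI _ (36 ^+ 2)); first by rewrite expf_neq0.
rewrite -exprMn omegaPE phiPE.
set A := psiP k.+4 * psiP k.+1 ^+ 2; set B := psiP k * psiP k.+3 ^+ 2.
transitivity ((A + B) ^+ 2 - 4 * A * B); first by ring.
have -> : A + B =
    -18 * psiP k.+1 * psiP k.+2 * psiP k.+3 - 18 ^+ 2 * psiP k.+2 ^+ 3.
  by rewrite -T /A /B; ring.
have -> : 4 * A * B =
    4 * (psiP k.+4 * psiP k) * psiP k.+1 ^+ 2 * psiP k.+3 ^+ 2.
  by rewrite /A /B; ring.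
by rewrite S; ring.
Qed.

(** * Integers of known parity among the rationals *)

(** Integrality and parity travel together through the induction, so one
    predicate on rationals carries both. *)
Definition int_parity (b : bool) (x : rat) : Prop :=
  exists z : int, x = ((b : nat)%:Z + 2 * z)%:~R.

Lemma int_parityD b c x y :
  int_parity b x -> int_parity c y -> int_parity (b (+) c) (x + y).
Proof.
move=> [u ->] [v ->]; exists (u + v + (b && c : nat)%:Z).
by rewrite -rmorphD; congr (_%:~R); case: b c => [] [] /=; ring.
Qed.

Lemma int_parityM b c x y :
  int_parity b x -> int_parity c y -> int_parity (b && c) (x * y).
Proof.
move=> [u ->] [v ->]; exists (2 * u * v + (b : nat)%:Z * v + (c : nat)%:Z * u).
by rewrite -rmorphM; congr (_%:~R); case: b c => [] [] /=; ring.
Qed.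

Lemma int_parity_nat n : int_parity (odd n) n%:R.
Proof. by exists n./2; rewrite -[LHS]mulrz_nat; congr (_%:~R); lia. Qed.

Lemma int_parityN b x : int_parity b x -> int_parity b (- x).
Proof.
move=> [z ->]; exists (- z - (b : nat)%:Z).
by rewrite -rmorphN; congr (_%:~R); ring.
Qed.

Lemma int_parityX b x n : int_parity b x -> int_parity b (x ^+ n.+1).
Proof.
move=> hx; elim: n => [//|n IH]; rewrite exprS -[b]andbb; exact: int_parityM.
Qed.

Lemma int_parity_neq0 x : int_parity true x -> x != 0.
Proof. by move=> [z ->]; rewrite intr_eq0 /=; lia. Qed.

Lemma int_parity_uniq b c x : int_parity b x -> int_parity c x -> b = c.
Proof. by move=> [u ->] [v /intr_inj]; case: b c => [] [] //=; lia. Qed.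

Lemma int_parity_numq b x : int_parity b x -> (numq x)%:~R = x.
Proof. by move=> [z ->]; rewrite numq_int. Qed.

Lemma int_parity_odd_numq b x : int_parity b x -> odd `|numq x| = b.
Proof. by move=> [z ->]; rewrite numq_int; case: b => /=; lia. Qed.

(** A rational number with an integral square is an integer: its denominator
    divides the square of its numerator and is prime to it. This gives the
    integrality of omega_n without analysing the division by 4 y. *)
Lemma int_parity_sqrt b x : int_parity b (x ^+ 2) -> int_parity b x.
Proof.
move=> hx2; have [z Ez] := hx2; set t : int := (_ + _) in Ez.
have d1 : denq x = 1.
  have E : numq x ^+ 2 = t * denq x ^+ 2.
    apply: (@intr_inj rat).
    by rewrite [RHS]rmorphM !(rmorphXn intr) /= -Ez numqE; ring.
  have dv : (`|denq x| %| `|numq x| ^ 2)%N.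
    by rewrite -abszX E abszM abszX dvdn_mull // dvdn_mulr.
  have := coprime_num_den x; rewrite coprime_sym => co.
  move: dv; rewrite -[X in (_ %| X)%N]muln1 Gauss_dvdr ?coprimeXr // dvdn1.
  by have := denq_gt0 x; lia.
have Ex : x = (numq x)%:~R by rewrite numqE d1 mulr1.
have hx : int_parity (odd `|numq x|) x.
  exists ((numq x - (odd `|numq x|)%:Z) %/ 2)%Z.
  by rewrite [LHS]Ex; congr (_%:~R); lia.
by rewrite (int_parity_uniq hx2 (int_parityX 1 hx)).
Qed.

(** * The Somos-4 relation for psi at P *)

(** psi_n ^ 2 has the parity of n and psi_(n+1) psi_(n-1) the opposite one. *)
Lemma phiP_odd n :
  (forall m, (m < n.+3)%N -> int_parity (odd m) (psiP m)) ->
  int_parity true (phiP n.+1).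
Proof.
move=> par; rewrite phiPE.
have -> : true = (true && odd n.+1) (+) (odd n.+2 && odd n).
  by rewrite /=; case: odd.
apply: int_parityD; last by apply/int_parityN/int_parityM; apply: par; lia.
apply: int_parityM; first exact: (int_parityN (int_parity_nat 3)).
by apply: int_parityX; apply: par; lia.
Qed.

Lemma omegaP_odd n :
  on_curve n.+1 -> (forall m, (m < n.+3)%N -> int_parity (odd m) (psiP m)) ->
  int_parity true (omegaP n.+1).
Proof.
move=> curve par; apply: int_parity_sqrt; rewrite curve.
have phi_odd := phiP_odd par.
have -> : true = true (+) (false && true && odd n.+1) by [].
apply: int_parityD; first exact: int_parityX.
apply: int_parityN; apply: int_parityM; last by apply: int_parityX; apply: par; lia.
exact: int_parityM (int_parity_nat 36) phi_odd.
Qed.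

Lemma on_curve1 : on_curve 1.
Proof. by rewrite /on_curve omegaP1 phiPE psiP1 psiP0; ring. Qed.

(** Stated below a bound [N], because it serves inside the induction on [N] as
    well as after it. *)
Lemma psiP_first_integral N :
  (forall m, (0 < m < N)%N -> psiP m != 0) ->
  (forall k, (k.+4 < N)%N -> somos4 (18 ^+ 2) 2997 psiP k) ->
  forall k, (k.+4 < N)%N -> somos4_first_integral (18 ^+ 2) (-18) psiP k.
Proof.
move=> nz somos; elim=> [|k IH] lt_kN.
  by rewrite /somos4_first_integral psiP0 psiP1 psiP2 psiP3 psiP4; ring.
apply: (@somos4_first_integralS _ _ 2997);
  [apply: nz|apply: somos|apply: somos|apply: IH]; lia.
Qed.

Lemma psiP_somos4_small k : (k <= 2)%N -> somos4 (18 ^+ 2) 2997 psiP k.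
Proof.
have -> : 2997 = - psiP 3 by rewrite psiP3 opprK.
exact: (somos4_initial psiP_odd psiP_even _ psiP0 psiP1 psiP2).
Qed.

(** The three facts need each other: the Somos-4 relation at a large index comes
    from smaller indices by dividing by nonzero terms; the terms are nonzero by
    parity, directly at odd indices and through psi_(2n) = 2 psi_n omega_n at
    even ones; and omega_n is an odd integer because the relations at smaller
    indices put nP on the curve. *)
Lemma psiP_spec N :
  [/\ int_parity (odd N) (psiP N), (0 < N)%N -> psiP N != 0
    & forall k, N = k.+4 -> somos4 (18 ^+ 2) 2997 psiP k].
Proof.
elim/ltn_ind: N => N IH.
have par m : (m < N)%N -> int_parity (odd m) (psiP m) by case/IH.
have nz m : (0 < m < N)%N -> psiP m != 0.
  by case/andP=> m0 /IH[_ h _]; exact: h.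
have somos k : (k.+4 < N)%N -> somos4 (18 ^+ 2) 2997 psiP k.
  by case/IH=> _ _; exact.
have fi := psiP_first_integral nz somos.
have [small|large] := leqP N 4.
  split; last by move=> k E; apply: psiP_somos4_small; lia.
    case: N small {IH par nz somos fi} => [|[|[|[|[|//]]]]] _.
    - by rewrite psiP0; exact: (int_parity_nat 0).
    - by rewrite psiP1; exact: (int_parity_nat 1).
    - by rewrite psiP2; exact: (int_parity_nat 18).
    - by rewrite psiP3; exact/int_parityN/(int_parity_nat 2997).
    - rewrite psiP4; apply: int_parityN; apply: (@int_parityM false true).
        exact: (int_parity_nat 140).
      exact: int_parityX (int_parity_nat 3).
  case: N small {IH par nz somos fi} => [|[|[|[|[|//]]]]] _ // _.
  - by rewrite psiP1.
  - by rewrite psiP2.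
  - by rewrite psiP3 oppr_eq0 pnatr_eq0.
  - by rewrite psiP4 oppr_eq0 mulf_neq0 // expf_neq0.
have [oddN|evenN] := boolP (odd N).
  have [m EN] : exists m, N = m.+2.*2.+1 by exists (N./2 - 2)%N; lia.
  have parN : int_parity true (psiP N).
    rewrite EN psiP_odd.
    (* Of the two products in the formula for psi_(2n+1), the one whose factors
       have odd indices is odd and the other is even. *)
    have -> : true = (odd m.+4 && odd m.+2) (+) (odd m.+1 && odd m.+3).
      by rewrite /=; case: odd.
    by apply: int_parityD; [|apply: int_parityN]; apply: int_parityM;
      try apply: int_parityX; apply: par; lia.
  split=> [//|_|k Ek]; first exact: int_parity_neq0.
  case: m EN => [|j] EN; first by apply: psiP_somos4_small; lia.
  have -> : k = j.+1.*2.+1 by lia.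
  by apply: (somos4_odd psiP_odd psiP_even);
    [apply: nz|apply: nz|apply: somos|apply: somos]; lia.
have [m EN] : exists m, N = m.+3.*2 by exists (N./2 - 3)%N; lia.
have omega_odd : int_parity true (omegaP m.+3).
  apply: omegaP_odd; last by move=> i lt_i; apply: par; lia.
  by apply: on_curve_of_somos4; [apply: somos|apply: fi]; lia.
have EpsiN : psiP N = 2 * psiP m.+3 * omegaP m.+3 by rewrite EN psiP_double.
split=> [|_|k Ek].
- rewrite EpsiN; apply: (@int_parityM false true) => //.
  apply: (@int_parityM false (odd m.+3)); first exact: (int_parity_nat 2).
  by apply: par; lia.
- have nz_m : psiP m.+3 != 0 by apply: nz; lia.
  by rewrite EpsiN !mulf_neq0 // int_parity_neq0.
case: m EN {omega_odd EpsiN} => [|j] EN; first by apply: psiP_somos4_small; lia.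
have -> : k = j.+2.*2 by lia.
have nz18 : 18 != 0 :> rat by [].
by apply: (somos4_even psiP_odd psiP_even nz18);
  [apply: nz|apply: nz|apply: nz|apply: somos|apply: somos|apply: somos]; lia.
Qed.

Lemma psiP_parity n : int_parity (odd n) (psiP n).
Proof. by case: (psiP_spec n). Qed.

Lemma on_curve_psiP n : (0 < n)%N -> on_curve n.
Proof.
case: n => [|[|k]] // _; first exact: on_curve1.
apply: on_curve_of_somos4.
  by case: (psiP_spec k.+4) => _ _; exact.
apply: (@psiP_first_integral k.+4.+1) => // [m /andP[m0 _]|j _].
  by case: (psiP_spec m) => _ h _; exact: h.
by case: (psiP_spec j.+4) => _ _; exact.
Qed.

Lemma phiP_parity n : (0 < n)%N -> int_parity true (phiP n).
Proof. by case: n => // n _; apply: phiP_odd => m _; exact: psiP_parity. Qed.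

Lemma omegaP_parity n : (0 < n)%N -> int_parity true (omegaP n).
Proof.
case: n => // n _; apply: omegaP_odd; first exact: on_curve_psiP.
by move=> m _; exact: psiP_parity.
Qed.

(** * The quartic equation *)

Lemma quartic_identity (R : comPzRingType) (f w s : R) :
  w ^+ 2 = f ^+ 3 - 36 * f * s ^+ 4 ->
  let X := f ^+ 4 + 1296 * s ^+ 8 + 864 * f * s ^+ 6 + 72 * f ^+ 2 * s ^+ 4
    + 144 * w * s ^+ 5 - 24 * f ^+ 3 * s ^+ 2 + 4 * f ^+ 2 * w * s in
  let Y := - (864 * f * s ^+ 6) - f ^+ 4 - 1296 * s ^+ 8 - 72 * f ^+ 2 * s ^+ 4
    + 144 * w * s ^+ 5 + 24 * f ^+ 3 * s ^+ 2 + 4 * f ^+ 2 * w * s in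
  let U := 4 * (f ^+ 2 + 36 * s ^+ 4) * w * s in
  let V := (f ^+ 2 - 36 * s ^+ 4 - 12 * f * s ^+ 2)
    * (f ^+ 2 - 36 * s ^+ 4 + 12 * f * s ^+ 2) in
  X ^+ 4 + Y ^+ 4 = 2 * (U ^+ 4 + V ^+ 4).
Proof.
move=> Ew X Y U V.
(* X = U + A and Y = U - A, where U collects the terms that are odd in w. *)
pose A := f ^+ 4 - 24 * f ^+ 3 * s ^+ 2 + 72 * f ^+ 2 * s ^+ 4
  + 864 * f * s ^+ 6 + 1296 * s ^+ 8.
have -> : X = U + A by rewrite /X /U /A; ring.
have -> : Y = U - A by rewrite /Y /U /A; ring.
have EV : A ^+ 2 * (A ^+ 2 + 6 * U ^+ 2) = V ^+ 4.
  have -> : U ^+ 2 = 16 * (f ^+ 2 + 36 * s ^+ 4) ^+ 2 * s ^+ 2 * w ^+ 2.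
    by rewrite /U; ring.
  by rewrite Ew /A /V; ring.
by rewrite -EV; ring.
Qed.

(** Numerators stand for the integral values; see [quadE]. *)
Definition quad (n : nat) : int * int * int * int :=
  (numq (Xval n), numq (Yval n), numq (Uval n), numq (Vval n)).

Lemma psi_phi_omega_int n : (0 < n)%N ->
  exists f w s : int,
    [/\ phiP n = f%:~R, omegaP n = w%:~R & psiP n = s%:~R].
Proof.
move=> n0; exists (numq (phiP n)), (numq (omegaP n)), (numq (psiP n)).
by split; symmetry; apply: int_parity_numq;
  [apply: phiP_parity|apply: omegaP_parity|apply: psiP_parity].
Qed.

Lemma quadE n : (0 < n)%N ->
  [/\ Xval n = (numq (Xval n))%:~R, Yval n = (numq (Yval n))%:~R,
      Uval n = (numq (Uval n))%:~R & Vval n = (numq (Vval n))%:~R].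
Proof.
move=> n0; have [f [w [s [Ef Ew Es]]]] := psi_phi_omega_int n0.
have int_numq (x : rat) (z : int) : x = z%:~R -> x = (numq x)%:~R.
  by move=> ->; rewrite numq_int.
split.
- apply: (int_numq _ (f ^+ 4 + 1296 * s ^+ 8 + 864 * f * s ^+ 6
    + 72 * f ^+ 2 * s ^+ 4 + 144 * w * s ^+ 5 - 24 * f ^+ 3 * s ^+ 2
    + 4 * f ^+ 2 * w * s)).
  by rewrite /Xval Ef Ew Es; ring.
- apply: (int_numq _ (- (864 * f * s ^+ 6) - f ^+ 4 - 1296 * s ^+ 8
    - 72 * f ^+ 2 * s ^+ 4 + 144 * w * s ^+ 5 + 24 * f ^+ 3 * s ^+ 2
    + 4 * f ^+ 2 * w * s)).
  by rewrite /Yval Ef Ew Es; ring.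
- apply: (int_numq _ (4 * (f ^+ 2 + 36 * s ^+ 4) * w * s)).
  by rewrite /Uval Ef Ew Es; ring.
- apply: (int_numq _ ((f ^+ 2 - 36 * s ^+ 4 - 12 * f * s ^+ 2)
    * (f ^+ 2 - 36 * s ^+ 4 + 12 * f * s ^+ 2))).
  by rewrite /Vval Ef Es; ring.
Qed.

Lemma solution_numq (x y u v : rat) :
  x = (numq x)%:~R -> y = (numq y)%:~R -> u = (numq u)%:~R ->
  v = (numq v)%:~R -> x ^+ 4 + y ^+ 4 = 2 * (u ^+ 4 + v ^+ 4) ->
  solution (numq x, numq y, numq u, numq v).
Proof.
move=> Ex Ey Eu Ev E; apply: (@intr_inj rat).
by rewrite [RHS]rmorphM !rmorphD !(rmorphXn intr) /= -Ex -Ey -Eu -Ev.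
Qed.

Lemma quad_solution n : (0 < n)%N -> solution (quad n).
Proof.
move=> n0; have [EX EY EU EV] := quadE n0.
exact: solution_numq EX EY EU EV (quartic_identity (on_curve_psiP n0)).
Qed.

Lemma Vval_odd n : (0 < n)%N -> int_parity true (Vval n).
Proof.
move=> n0; have phi_odd := phiP_parity n0; have psi_par := psiP_parity n.
have even_part : int_parity false (12 * phiP n * psiP n ^+ 2).
  apply: (@int_parityM false (odd n)); last exact: int_parityX.
  exact: int_parityM (int_parity_nat 12) phi_odd.
have odd_part : int_parity true (phiP n ^+ 2 - 36 * psiP n ^+ 4).
  apply: (@int_parityD true false); first exact: int_parityX.
  apply: int_parityN; apply: (@int_parityM false (odd n)).
    exact: int_parity_nat 36.
  exact: int_parityX.
apply: (@int_parityM true true); last exact: int_parityD odd_part even_part.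
exact: int_parityD odd_part (int_parityN even_part).
Qed.

(** * Primitive solutions *)

(** Each doubling n to 2 n multiplies psi_n by 2 omega_n, and omega_n is odd. *)
Lemma psiP_pow2 k : exists2 y, int_parity true y & psiP (2 ^ k) = 2 ^+ k * y.
Proof.
elim: k => [|k [y y_odd Ey]].
  by exists 1; [exact: (int_parity_nat 1)|rewrite expn0 psiP1 mulr1].
have k0 : (0 < 2 ^ k)%N by rewrite expn_gt0.
exists (y * omegaP (2 ^ k)); first exact: (int_parityM y_odd (omegaP_parity k0)).
by rewrite expnS mul2n psiP_double // Ey exprS; ring.
Qed.

Lemma logn2_odd m : odd m -> logn 2 m = 0%N.
Proof. by move=> m_odd; apply/logn_coprime; rewrite coprime2n. Qed.

Lemma logn2_numq k y :
  int_parity true y -> logn 2 `|numq (2 ^+ k * y)| = k.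
Proof.
move=> y_par; have := int_parity_odd_numq y_par.
rewrite -(int_parity_numq y_par) numq_int; move: (numq y) => z z_odd.
have -> : 2 ^+ k * z%:~R = (2 ^+ k * z)%:~R :> rat.
  by rewrite rmorphM (rmorphXn intr).
rewrite numq_int abszM abszX lognM ?expn_gt0 //; last by case: `|z|%N z_odd.
by rewrite lognX logn_prime // eqxx muln1 (logn2_odd z_odd) addn0.
Qed.

Lemma logn2_Uval_pow2 k : logn 2 `|numq (Uval (2 ^ k))| = k.+2.
Proof.
have n0 : (0 < 2 ^ k)%N by rewrite expn_gt0.
have [y y_odd Ey] := psiP_pow2 k; set n := (2 ^ k)%N in n0 Ey *.
pose z := (phiP n ^+ 2 + 36 * psiP n ^+ 4) * omegaP n * y.
have -> : Uval n = 2 ^+ k.+2 * z by rewrite /Uval /z {2}Ey !exprS; ring.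
apply: logn2_numq; apply: (@int_parityM true true) => //.
apply: (@int_parityM true true); last exact: omegaP_parity.
apply: (@int_parityD true false); first exact: int_parityX (phiP_parity n0).
apply: (@int_parityM false (odd n)); first exact: (int_parity_nat 36).
exact: int_parityX (psiP_parity n).
Qed.

Definition primitive_part (q : int * int * int * int) : int * int * int * int :=
  let: (X, Y, U, V) := q in
  let d := gcd4 X Y U V in
  ((X %/ d)%Z, (Y %/ d)%Z, (U %/ d)%Z, (V %/ d)%Z).

Lemma dvdz_gcd4 (a b c d : int) : let g := gcd4 a b c d in
  [/\ (g %| a)%Z, (g %| b)%Z, (g %| c)%Z & (g %| d)%Z].
Proof.
move=> g.
have abc : (g %| gcdz (gcdz a b) c)%Z := dvdz_gcdl _ _.
have ab := dvdz_trans abc (dvdz_gcdl _ _).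
split; [exact: dvdz_trans ab (dvdz_gcdl _ _)|exact: dvdz_trans ab (dvdz_gcdr _ _)
  |exact: dvdz_trans abc (dvdz_gcdr _ _)|exact: dvdz_gcdr].
Qed.

Lemma gcd4M (a b c e d : int) :
  gcd4 (a * d) (b * d) (c * d) (e * d) = gcd4 a b c e * `|d|%N.
Proof. by rewrite /gcd4 /gcdz !absz_nat !abszM -!muln_gcdl PoszM. Qed.

Lemma primitive_part_solution (X Y U V : int) :
  V != 0 -> solution (X, Y, U, V) ->
  primitive_solution (primitive_part (X, Y, U, V)).
Proof.
move=> V0; rewrite /primitive_part; cbv zeta.
have := dvdz_gcd4 X Y U V; set d := gcd4 X Y U V; cbv zeta.
case=> /divzK EX /divzK EY /divzK EU /divzK EV.
have d0 : d != 0 by apply: contraNneq V0 => d0; rewrite -EV d0 mulr0.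
have Ed : (`|d|%N)%:Z = d by [].
rewrite /primitive_solution /solution.
move: (X %/ d)%Z (Y %/ d)%Z (U %/ d)%Z (V %/ d)%Z EX EY EU EV => x y u v EX EY EU EV.
rewrite -{1}EX -{1}EY -{1}EU -{1}EV => E; split.
  apply: (mulIf (expf_neq0 4 d0)); transitivity ((x * d) ^+ 4 + (y * d) ^+ 4).
    by ring.
  by rewrite E; ring.
apply: (mulIf d0); rewrite mul1r -[X in _ * X = _]Ed -gcd4M.
by rewrite EX EY EU EV.
Qed.

Lemma quad_primitive n : (0 < n)%N -> primitive_solution (primitive_part (quad n)).
Proof.
move=> n0; apply: primitive_part_solution (quad_solution n0).
have := int_parity_odd_numq (Vval_odd n0).
by case: eqP => // ->.
Qed.

Lemma logn2_primitive_U k (a b c d : int) :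
  primitive_part (quad (2 ^ k)) = (a, b, c, d) -> logn 2 `|c| = k.+2.
Proof.
have n0 : (0 < 2 ^ k)%N by rewrite expn_gt0.
have := dvdz_gcd4 (numq (Xval (2 ^ k))) (numq (Yval (2 ^ k)))
  (numq (Uval (2 ^ k))) (numq (Vval (2 ^ k))).
have := logn2_Uval_pow2 k; have := int_parity_odd_numq (Vval_odd n0).
rewrite /primitive_part /quad; cbv zeta.
move: (numq (Xval _)) (numq (Yval _)) (numq (Uval _)) (numq (Vval _)).
move=> X Y U V V_odd.
set g := gcd4 _ _ _ _ => logU [_ _ gU gV] [_ _ <- _].
have g_odd : odd `|g| by apply: dvdn_odd gV _; rewrite V_odd.
have U0 : U != 0 by apply: contra_eq_neq logU => ->; rewrite logn0.
move: logU; rewrite -{1}(divzK gU) abszM lognM.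
- by rewrite (logn2_odd g_odd) addn0.
- by rewrite absz_gt0; apply: contraNneq U0 => E; rewrite -(divzK gU) E mul0r.
- by case: `|g|%N g_odd.
Qed.

(** The 2-adic valuation k + 2 of the third coordinate recovers k. *)
Lemma primitive_quad_pow2_inj : injective (fun k => primitive_part (quad (2 ^ k))).
Proof.
move=> i j; case Ei: (primitive_part _) => [[[a b] c] d] /esym Ej.
by have := logn2_primitive_U Ei; rewrite (logn2_primitive_U Ej); lia.
Qed.

Lemma infinite_primitive_solutions : infinite_set [set q | primitive_solution q].
Proof.
apply/infiniteP.
pose f k := primitive_part (quad (2 ^ k)).
have -> : [set: nat] = (f @^-1` [set q | primitive_solution q])%classic.
  apply/seteqP; split=> // k _ /=.
  by apply: quad_primitive; rewrite expn_gt0.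
by apply: card_ge_preimage => i j _ _; exact: primitive_quad_pow2_inj.
Qed.

Theorem mainTheorem2 :
  (forall n : nat, (1 <= n)%N ->
     exists X Y U V : int,
       [/\ Xval n = X%:~R, Yval n = Y%:~R, Uval n = U%:~R & Vval n = V%:~R] /\
       solution (X, Y, U, V) /\
       (let d := gcd4 X Y U V in
        primitive_solution
          ((X %/ d)%Z, (Y %/ d)%Z, (U %/ d)%Z, (V %/ d)%Z))) /\
  infinite_set [set q | solution q] /\
  infinite_set [set q | primitive_solution q].
Proof.
split; last first.
  split; last exact: infinite_primitive_solutions.
  by apply: sub_infinite_set infinite_primitive_solutions => q [].
move=> n n0.
exists (numq (Xval n)), (numq (Yval n)), (numq (Uval n)), (numq (Vval n)).
split; first exact: quadE.
by split; [exact: quad_solution|exact: (quad_primitive n0)].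
Qed.
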